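(* For every fixed positive integer $k$, the problems $\mathbf{SSP}(\mathcal{M}_{\max,\times}^k)$ and $\mathbf{KP}(\mathcal{M}_{\max,\times}^k)$ are decidable generically in polynomial time with respect to the stratification $\{U_m\}_m$: for each of them there is an algorithm that halts on every input $I\in U$ in time polynomial in $\mathrm{size}_2(I)$, outputs either the correct answer (true/false) or ''?'', and the set of inputs on which it does not output ''?'' has asymptotic density $1$.
   Context: $\mathcal{M}_{\max,\times}^k$ is the semigroup $\mathrm{Mat}_k(\mathbb{Z}_{\geq 1})$ with $(A\otimes B)_{ij}=\max_{l}(a_{il}\cdot b_{lj})$. In $W_1^{\otimes x_1}\otimes\cdots\otimes W_n^{\otimes x_n}$ a factor with $x_i=0$ is omitted and the all-zero exponent vector is not allowed. $\mathbf{SSP}(\mathcal{S})$: given $W_1,\dots,W_n,C\in\mathcal{S}$, decide whether some $x\in\{0,1\}^n$, not all zero, satisfies $W_1^{\otimes x_1}\otimes\cdots\otimes W_n^{\otimes x_n}=C$; $\mathbf{KP}(\mathcal{S})$: the same with $x\in\mathbb{Z}_{\ge0}^n$. Sizes: $\mathrm{size}_2(a)=\lfloor\log_2 a\rfloor+1$ for $a\ge1$; $\mathrm{size}_2(A)=\sum_{i,j}\mathrm{size}_2(a_{ij})+k^2-1$; $\mathrm{size}_2(W_1,\dots,W_n,C)=\sum_i\mathrm{size}_2(W_i)+\mathrm{size}_2(C)+n$. $U$ is the set of all tuples $(W_1,\dots,W_n,C)$ with $n\ge0$ and entries in $\mathrm{Mat}_k(\mathbb{Z}_{\geq 1})$;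 $U_m=\{I\in U:\mathrm{size}_2(I)=m\}$. The asymptotic density of $A\subseteq U$ is $\rho(A)=\lim_{m\to\infty}|A\cap U_m|/|U_m|$ (over $m$ with $U_m\ne\emptyset$). *)

(* Defs.v *)
From mathcomp Require Import all_boot all_order all_algebra.
Set Implicit Arguments. Unset Strict Implicit. Unset Printing Implicit Defensive.
Import Order.TTheory GRing.Theory Num.Theory.

(* The semigroup M^k_{max,x}: k x k matrices over Z_{>=1} (entries    *)
(* are nat, positivity is imposed by [valid_mx]) with max-times       *)
(* product (A (x) B)_{ij} = max_l a_{il} * b_{lj}.                    *)
Section MaxTimes.
Variable k : nat.
Definition mx := 'M[nat]_k.

Definition valid_mx (A : mx) : Prop := forall i j, 0 < A i j.

Definition mxmul (A B : mx) : mx := (\matrix_(i, j) (\max_(l < k) (A i l * B l j))%N)%R.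

Definition mxprod (s : seq mx) : option mx :=
  if s is A :: s' then Some (foldl mxmul A s') else None.

Definition factors (xs : seq nat) (Ws : seq mx) : seq mx :=
  flatten (map (fun p => nseq p.1 p.2) (zip xs Ws)).

Definition inst := (seq mx * mx)%type.

Definition valid_inst (I : inst) : Prop :=
  (forall W, W \in I.1 -> valid_mx W) /\ valid_mx I.2.

Definition SSP (I : inst) : Prop :=
  exists xs : seq nat, size xs = size I.1 /\ all (fun x => x <= 1) xs /\
    has (fun x => 0 < x) xs /\ mxprod (factors xs I.1) = Some I.2.

Definition KP (I : inst) : Prop :=
  exists xs : seq nat, size xs = size I.1 /\
    has (fun x => 0 < x) xs /\ mxprod (factors xs I.1) = Some I.2.

Definition size2 (a : nat) : nat := (trunc_log 2 a).+1.
Definition size2_mx (A : mx) : nat :=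
  \sum_(i < k) \sum_(j < k) size2 (A i j) + k ^ 2 - 1.
Definition size2_inst (I : inst) : nat :=
  \sum_(W <- I.1) size2_mx W + size2_mx I.2 + size I.1.

(* Binary encoding of instances over the tape alphabet                *)
(*   0 = blank, 1 = bit 0, 2 = bit 1, 3 = entry separator,            *)
(*   4 = matrix separator.                                            *)
Definition bits (a : nat) : seq bool :=
  rev (mkseq (fun i => odd (a %/ 2 ^ i)) (trunc_log 2 a).+1).
Definition enc_nat (a : nat) : seq nat :=
  map (fun b : bool => if b then 2 else 1) (bits a).
Definition enc_mx (A : mx) : seq nat :=
  flatten [seq enc_nat (A i j) ++ [:: 3] | i <- enum 'I_k, j <- enum 'I_k] ++ [:: 4].
Definition enc_inst (I : inst) : seq nat :=
  flatten (map enc_mx I.1) ++ enc_mx I.2.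
End MaxTimes.

(* Deterministic one-tape Turing machines. A machine is a finite       *)
(* transition table of entries ((q, a), (q', b, d)): in state q        *)
(* reading a, go to q', write b, move d. States and symbols are        *)
(* naturals, but only finitely many occur in the table. The machine    *)
(* halts when no entry applies. Start state 0; halting in state 1     *)
(* means "true", 2 means "false", 3 means "?".                         *)
Inductive move := MLeft | MRight | MStay.
Definition tm := seq ((nat * nat) * ((nat * nat) * move)).

Record config := Config { cst : nat; cleft : seq nat; ccur : nat; cright : seq nat }.

Definition lookup (T : tm) (q a : nat) : option ((nat * nat) * move) :=
  match [seq t <- T | (t.1.1 == q) && (t.1.2 == a)] with
  | [::] => None
  | t :: _ => Some t.2
  end.

Definition step (T : tm) (c : config) : option config :=
  match lookup T (cst c) (ccur c) with
  | None => None
  | Some ((q', b), d) =>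
    Some (match d with
          | MStay => Config q' (cleft c) b (cright c)
          | MRight => Config q' (b :: cleft c) (head 0 (cright c)) (behead (cright c))
          | MLeft => Config q' (behead (cleft c)) (head 0 (cleft c)) (b :: cright c)
          end)
  end.

Definition halted (T : tm) (c : config) : Prop := step T c = None.

Fixpoint exec (T : tm) (t : nat) (c : config) : config :=
  match t with
  | 0 => c
  | t'.+1 => match step T c with None => c | Some c' => exec T t' c' end
  end.

Definition init_config (w : seq nat) : config := Config 0 [::] (head 0 w) (behead w).

Definition is_count (T : eqType) (P : T -> Prop) (N : nat) : Prop :=
  exists s : seq T, uniq s /\ (forall x, x \in s <-> P x) /\ size s = N.

Definition density_one (k : nat) (A : inst k -> Prop) : Prop :=
  forall cU cA : nat -> nat,
    (forall m, is_count (fun I : inst k => valid_inst I /\ size2_inst I = m) (cU m)) ->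
    (forall m, is_count (fun I : inst k => [/\ valid_inst I, size2_inst I = m & A I]) (cA m)) ->
    forall e : rat, (0 < e)%R -> exists M : nat, forall m : nat, (M <= m)%N -> (0 < cU m)%N ->
      ((cU m)%:R - (cA m)%:R <= e * (cU m)%:R)%R.

Definition generic_ptime (k : nat) (P : inst k -> Prop) : Prop :=
  exists (T : tm) (c d : nat),
    (forall I : inst k, valid_inst I ->
       exists t, t <= c * (size2_inst I) ^ d + c /\
         let cf := exec T t (init_config (enc_inst I)) in
         halted T cf /\ cst cf \in [:: 1; 2; 3] /\
         (cst cf = 1 -> P I) /\ (cst cf = 2 -> ~ P I)) /\
    density_one (fun I : inst k => exists t,
       let cf := exec T t (init_config (enc_inst I)) in
       halted T cf /\ cst cf \in [:: 1; 2]).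

(* Main.v *)
Require Import Defs.
From mathcomp Require Import all_boot all_order all_algebra.
From mathcomp Require Import zify.
Set Implicit Arguments. Unset Strict Implicit. Unset Printing Implicit Defensive.
Import Order.TTheory GRing.Theory Num.Theory.

(* If C is one of the W_i, both problems have the answer "true"; a machine can *)
(* test this in quadratic time and answer "?" otherwise. It remains to see     *)
(* that C is generically one of the W_i.                                       *)
(* - C is rarely large: an entry of C with many bits can be cut in two at any  *)
(*   of D places, C being replaced by two matrices W_{n+1} and C'; dropping    *)
(*   2k^2 bits of the entry keeps the size unchanged, so D choices are paid    *)
(*   by a loss of information which does not depend on D.                      *)
(* - Exchanging C with some W_i is a size-preserving involution. Hence n is    *)
(*   rarely bounded (some W_i would then be large, and could become C), and a  *)
(*   small C which is none of the W_i is rare when n > T, since it is sent to  *)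
(*   n instances while an instance comes from at most as many such C as there  *)
(*   are small matrices.                                                       *)

(** * Runs of a machine *)

(** The algorithm only searches for the target among the weights. A hit gives a solution with a
    single exponent 1 ([SSP_mem], [KP_mem]); after a miss the machine halts in state 3, and it never
    answers false. [matcher_enc] supplies correctness and a quadratic time bound, so one machine
    serves both problems.

    The density claim is [count_missing_target]: for every E, in all strata of large enough size at
    most one instance in E has a target that is not a weight. Its estimates have constants
    independent of the stratum. [count_large_target] bounds the instances with a large target
    through the injection [cut_inst]. [sum_swap] counts pairs (instance, index) in two ways under
    the exchange of target and weight; it yields [count_small_bad] for small missing targets in long
    instances and [count_short] for short instances with a large weight. By [short_stratum] a short
    instance of large size contains a large matrix, so no case is left. *)

Section Runs.
Variable T : tm.
Implicit Types (q a b n : nat) (c : config) (L W l : seq nat).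

(** Two views of a configuration, with the head on the first symbol of [W] or of [L]: a right move
    ends naturally in the first form, a left move in the second. The default 0 is the blank met
    beyond the written part. *)
Definition cfgR q L W := Config q L (head 0 W) (behead W).
Definition cfgL q L W := Config q (behead L) (head 0 L) W.

(** Quantifying over the remaining time [m] makes runs compose by rewriting. *)
Definition runs n c c' := forall m, exec T (n + m) c = exec T m c'.

Lemma runs0 c : runs 0 c c.
Proof. by []. Qed.

Lemma runs_step c c' : step T c = Some c' -> runs 1 c c'.
Proof. by move=> h m; rewrite add1n /= h. Qed.

Lemma runs_trans n1 n2 c1 c2 c3 :
  runs n1 c1 c2 -> runs n2 c2 c3 -> runs (n1 + n2) c1 c3.
Proof. by move=> h1 h2 m; rewrite -addnA h1 h2. Qed.

Lemma runs_RR q a q' b L W : lookup T q a = Some (q', b, MRight) ->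
  runs 1 (cfgR q L (a :: W)) (cfgR q' (b :: L) W).
Proof. by move=> h; apply: runs_step; rewrite /step /= h. Qed.

Lemma runs_RL q q' b L W : lookup T q (head 0 W) = Some (q', b, MLeft) ->
  runs 1 (cfgR q L W) (cfgL q' L (b :: behead W)).
Proof. by move=> h; apply: runs_step; rewrite /step /= h. Qed.

Lemma runs_LR q q' b L W : lookup T q (head 0 L) = Some (q', b, MRight) ->
  runs 1 (cfgL q L W) (cfgR q' (b :: behead L) W).
Proof. by move=> h; apply: runs_step; rewrite /step /= h. Qed.

Lemma runs_LL q a q' b L W : lookup T q a = Some (q', b, MLeft) ->
  runs 1 (cfgL q (a :: L) W) (cfgL q' L (b :: W)).
Proof. by move=> h; apply: runs_step; rewrite /step /= h. Qed.

Lemma runs_scanR q l L W :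
  (forall a, a \in l -> lookup T q a = Some (q, a, MRight)) ->
  runs (size l) (cfgR q L (l ++ W)) (cfgR q (rev l ++ L) W).
Proof.
elim: l L => [|a l IHl] L h; first exact: runs0.
rewrite rev_cons cat_rcons /= -add1n.
apply: runs_trans (runs_RR _ _ (h a _)) _; first exact: mem_head.
by apply: IHl => b bl; apply: h; rewrite inE bl orbT.
Qed.

Lemma runs_scanL q l L W :
  (forall a, a \in l -> lookup T q a = Some (q, a, MLeft)) ->
  runs (size l) (cfgL q (l ++ L) W) (cfgL q L (rev l ++ W)).
Proof.
elim: l W => [|a l IHl] W h; first exact: runs0.
rewrite rev_cons cat_rcons /= -add1n.
apply: runs_trans (runs_LL _ _ (h a _)) _; first exact: mem_head.
by apply: IHl => b bl; apply: h; rewrite inE bl orbT.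
Qed.

End Runs.

(** * A machine comparing blocks *)

(* The head enters at state 0, finds the last block v (states 4 to 7), and in  *)
(* state 8 overwrites by 8 the first symbol s of v not yet overwritten.        *)
(* It then goes back to the left end (state 10 + s) and sweeps to the right;   *)
(* in each block the first symbol different from 5 is compared with s (state   *)
(* 20 + s) and replaced by 5 if equal (then state 30 + s up to the end of the  *)
(* block), otherwise the terminator 4 of the block becomes 7 (state 40 + s).   *)
(* Once s is the terminator of v, a block ...5554 met in state 24 equals v.    *)
Definition matcher : tm :=
  [seq ((0, a), ((4, a), MLeft)) | a <- [:: 1; 2; 3; 4]] ++
  [:: ((4, 0), ((5, 0), MRight))] ++
  [seq ((5, a), ((5, a), MRight)) | a <- [:: 1; 2; 3; 4]] ++
  [:: ((5, 0), ((6, 0), MLeft)); ((6, 4), ((7, 4), MLeft))] ++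
  [seq ((7, a), ((7, a), MLeft)) | a <- [:: 1; 2; 3]] ++
  [seq ((7, a), ((8, a), MRight)) | a <- [:: 0; 4]] ++
  [:: ((8, 8), ((8, 8), MRight))] ++
  [seq ((8, s), ((10 + s, 8), MLeft)) | s <- [:: 1; 2; 3; 4]] ++
  [seq ((10 + s, a), ((10 + s, a), MLeft))
     | s <- [:: 1; 2; 3; 4], a <- [:: 1; 2; 3; 4; 5; 7; 8]] ++
  [seq ((10 + s, 0), ((20 + s, 0), MRight)) | s <- [:: 1; 2; 3; 4]] ++
  [:: ((24, 4), ((1, 4), MStay)); ((24, 8), ((3, 8), MStay))] ++
  [seq ((20 + s, a), ((20 + s, a), MRight))
     | s <- [:: 1; 2; 3; 4], a <- [:: 5; 7]] ++
  [seq ((20 + s, 4), ((20 + s, 7), MRight)) | s <- [:: 1; 2; 3]] ++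
  [seq ((20 + s, 8), ((8, 8), MRight)) | s <- [:: 1; 2; 3]] ++
  [seq ((20 + s, a), (if a == s then (30 + s, 5) else (40 + s, a), MRight))
     | s <- [:: 1; 2; 3; 4], a <- [:: 1; 2; 3]] ++
  [seq ((30 + s, a), ((30 + s, a), MRight))
     | s <- [:: 1; 2; 3], a <- [:: 1; 2; 3]] ++
  [seq ((30 + s, a), ((20 + s, a), MRight))
     | s <- [:: 1; 2; 3], a <- [:: 4; 7]] ++
  [seq ((40 + s, a), ((40 + s, a), MRight))
     | s <- [:: 1; 2; 3; 4], a <- [:: 1; 2; 3]] ++
  [seq ((40 + s, a), ((20 + s, 7), MRight))
     | s <- [:: 1; 2; 3; 4], a <- [:: 4; 7]].

Section Matcher.
Implicit Types (s a : nat) (u v r L W : seq nat) (b : nat * seq nat * bool).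

Local Notation runs := (runs matcher).
Local Notation look := (lookup matcher).

Definition letters := [:: 1; 2; 3].
Definition symbols := [:: 1; 2; 3; 4].
Definition marked := [:: 1; 2; 3; 4; 5; 7; 8].

Lemma letters_symbols : {subset letters <= symbols}.
Proof. by move=> s; rewrite !inE => /or3P[] ->; rewrite ?orbT. Qed.

Lemma look_match s a : s \in symbols -> a \in letters ->
  look (20 + s) a = Some (if a == s then (30 + s, 5) else (40 + s, a), MRight).
Proof. by rewrite !inE => /or4P[] /eqP -> /or3P[] /eqP ->. Qed.

Lemma look_match_skip s a : s \in symbols -> a \in [:: 5; 7] ->
  look (20 + s) a = Some (20 + s, a, MRight).
Proof. by rewrite !inE => /or4P[] /eqP -> /orP[] /eqP ->. Qed.

Lemma look_match_end s : s \in letters ->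
  look (20 + s) 4 = Some (20 + s, 7, MRight).
Proof. by rewrite !inE => /or3P[] /eqP ->. Qed.

Lemma look_match_last s : s \in letters ->
  look (20 + s) 8 = Some (8, 8, MRight).
Proof. by rewrite !inE => /or3P[] /eqP ->. Qed.

Lemma look_skip s a : s \in letters -> a \in letters ->
  look (30 + s) a = Some (30 + s, a, MRight).
Proof. by rewrite !inE => /or3P[] /eqP -> /or3P[] /eqP ->. Qed.

Lemma look_skip_end s a : s \in letters -> a \in [:: 4; 7] ->
  look (30 + s) a = Some (20 + s, a, MRight).
Proof. by rewrite !inE => /or3P[] /eqP -> /orP[] /eqP ->. Qed.

Lemma look_fail s a : s \in symbols -> a \in letters ->
  look (40 + s) a = Some (40 + s, a, MRight).
Proof. by rewrite !inE => /or4P[] /eqP -> /or3P[] /eqP ->. Qed.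

Lemma look_fail_end s a : s \in symbols -> a \in [:: 4; 7] ->
  look (40 + s) a = Some (20 + s, 7, MRight).
Proof. by rewrite !inE => /or4P[] /eqP -> /orP[] /eqP ->. Qed.

Lemma look_rewind s a : s \in symbols -> a \in marked ->
  look (10 + s) a = Some (10 + s, a, MLeft).
Proof.
rewrite !inE => /or4P[] /eqP -> /predU1P[->|] // /predU1P[->|] // /predU1P[->|] //;
by move=> /predU1P[->|] // /predU1P[->|] // /orP[] /eqP ->.
Qed.

Lemma look_rewind_end s : s \in symbols -> look (10 + s) 0 = Some (20 + s, 0, MRight).
Proof. by rewrite !inE => /or4P[] /eqP ->. Qed.

Lemma look_pick s : s \in symbols -> look 8 s = Some (10 + s, 8, MLeft).
Proof. by rewrite !inE => /or4P[] /eqP ->. Qed.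

(* A block is (number of symbols consumed, symbols left, no mismatch so far). *)
Definition block_tape b : seq nat :=
  nseq b.1.1 5 ++ b.1.2 ++ [:: if b.2 then 4 else 7].
(** A wrong letter and an exhausted block both clear the flag for good. Every case preserves the
    length of the block on the tape. *)
Definition block_update b s : nat * seq nat * bool :=
  if b.1.2 is x :: r then
    if x == s then (b.1.1.+1, r, b.2) else (b.1, false)
  else (b.1, false).
Definition block_ok b := all (mem letters) b.1.2.
Definition block_matched b := nilp b.1.2 && b.2.
Definition blocks_tape bs := flatten (map block_tape bs).

Lemma block_update_ok b s : block_ok b -> block_ok (block_update b s).
Proof.
case: b => [[a [|x r]] t] //=; rewrite /block_update /block_ok /=.
by case: eqP => //= _ /andP[].
Qed.

Lemma size_block_update b s : size (block_tape (block_update b s)) = size (block_tape b).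
Proof.
case: b => [[a [|x r]] t]; rewrite /block_update /block_tape /=.
  by rewrite !size_cat.
by case: eqP => _ /=; rewrite ?size_cat /= ?size_cat ?size_nseq /= ?addSn ?addnS.
Qed.

Lemma sub_marked b : block_ok b -> {subset block_tape b <= marked}.
Proof.
case: b => [[a r] t] /= /allP h x; rewrite /block_tape !mem_cat mem_nseq /=.
case/or3P => [/andP[_ /eqP ->] //|/h|]; first by rewrite !inE => /or3P[] ->; rewrite ?orbT.
by rewrite inE => /eqP ->; case: (t).
Qed.

Lemma runs_fail s r (t : bool) L W : s \in symbols -> all (mem letters) r ->
  runs (size r).+1 (cfgR (40 + s) L (r ++ (if t then 4 else 7) :: W))
    (cfgR (20 + s) (7 :: rev r ++ L) W).
Proof.
move=> hs /allP hr; rewrite -addn1; apply: runs_trans (runs_scanR _ _ _) _.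
  by move=> x /hr; apply: look_fail.
by apply/runs_RR/look_fail_end => //; case: t.
Qed.

Lemma runs_consume s r (t : bool) L W : s \in letters -> all (mem letters) r ->
  runs (size r).+1 (cfgR (30 + s) L (r ++ (if t then 4 else 7) :: W))
    (cfgR (20 + s) ((if t then 4 else 7) :: rev r ++ L) W).
Proof.
move=> hs /allP hr; rewrite -addn1; apply: runs_trans (runs_scanR _ _ _) _.
  by move=> x /hr; apply: look_skip.
by apply/runs_RR/look_skip_end => //; case: t.
Qed.

Lemma runs_fives s n L W : s \in symbols ->
  runs n (cfgR (20 + s) L (nseq n 5 ++ W)) (cfgR (20 + s) (nseq n 5 ++ L) W).
Proof.
move=> hs; have := @runs_scanR matcher (20 + s) (nseq n 5) L W.
rewrite size_nseq rev_nseq; apply=> x.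
by rewrite mem_nseq => /andP[_ /eqP ->]; apply: look_match_skip.
Qed.

Lemma rev_block_tape n r (t : bool) L :
  rev (block_tape (n, r, t)) ++ L = (if t then 4 else 7) :: rev r ++ nseq n 5 ++ L.
Proof. by rewrite /block_tape !rev_cat rev_nseq /= -!catA. Qed.

(** For [s] equal to 4 the machine halts and accepts inside a matched block, which the last
    hypothesis excludes. An unmatched block then either shows a letter, necessarily different from
    4, or already ends in 7. *)
Lemma runs_block s b L W : s \in symbols -> block_ok b ->
  (s == 4) ==> ~~ block_matched b ->
  runs (size (block_tape b)) (cfgR (20 + s) L (block_tape b ++ W))
    (cfgR (20 + s) (rev (block_tape (block_update b s)) ++ L) W).
Proof.
case: b => [[n r] t] hs /= hr hm.
rewrite {1 2}/block_tape /= -!catA size_cat size_nseq.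
apply: runs_trans (runs_fives _ _ _ hs) _.
case: r hr hm => [_|x r /andP[/= hx hr] _]; rewrite /block_update /=.
  rewrite rev_block_tape; case: t => hm; apply: runs_RR.
    apply: look_match_end => //.
    by move: hm hs; rewrite /block_matched /= implybF !inE => /negPf ->; rewrite orbF.
  exact: look_match_skip.
rewrite size_cat addn1 -add1n.
have /= hl := look_match hs hx.
case: (eqVneq x s) hl => [xs|xs] hl; apply: runs_trans (runs_RR _ _ hl) _.
  by rewrite rev_block_tape; apply: runs_consume => //; rewrite -xs.
by rewrite rev_block_tape rev_cons cat_rcons; apply: runs_fail.
Qed.

Lemma runs_blocks s bs L W : s \in symbols -> all block_ok bs ->
  (s == 4) ==> ~~ has block_matched bs ->
  runs (size (blocks_tape bs)) (cfgR (20 + s) L (blocks_tape bs ++ W))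
    (cfgR (20 + s) (rev (blocks_tape [seq block_update b s | b <- bs]) ++ L) W).
Proof.
move=> hs; elim: bs L => [|b bs IH] L /=; first by move=> _ _; exact: runs0.
case/andP=> hb hbs hm; rewrite /blocks_tape /= size_cat -catA.
apply: runs_trans (runs_block _ _ hs hb _) _.
  by move: hm; case: (s == 4) => //=; rewrite negb_or => /andP[].
rewrite rev_cat -catA; apply: IH => //.
by move: hm; case: (s == 4) => //=; rewrite negb_or => /andP[].
Qed.

Lemma size_blocks_update s bs :
  size (blocks_tape [seq block_update b s | b <- bs]) = size (blocks_tape bs).
Proof.
elim: bs => //= b bs IH; rewrite /blocks_tape /=.
by rewrite size_cat size_block_update [RHS]size_cat; congr (_ + _).
Qed.

(** Start of a round: [j] symbols of the last block are already overwritten by 8, and [Z] begins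
    with the next one. The 0 is the blank cell left of the input, where rewinding stops. *)
Definition pick_cfg bs j Z := cfgR 8 (nseq j 8 ++ rev (blocks_tape bs) ++ [:: 0]) Z.

Lemma runs_rewind s bs j Z : s \in symbols -> all block_ok bs ->
  runs (j + size (blocks_tape bs)).+2 (pick_cfg bs j (s :: Z))
    (cfgR (20 + s) [:: 0] (blocks_tape bs ++ nseq j.+1 8 ++ Z)).
Proof.
move=> hs hbs; rewrite -addn1 -add1n.
apply: runs_trans (runs_trans (@runs_RL _ _ (10 + s) 8 _ (s :: Z) (look_pick hs)) _) _;
  last first.
- exact/(@runs_LR _ _ _ 0 [:: 0])/look_rewind_end.
- have := @runs_scanL matcher (10 + s) (nseq j 8 ++ rev (blocks_tape bs)) [:: 0] (8 :: Z).
  rewrite size_cat size_nseq size_rev rev_cat revK rev_nseq -!catA /=.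
  have -> : nseq j 8 ++ 8 :: Z = 8 :: nseq j 8 ++ Z by elim: (j) => //= i ->.
  apply=> a; rewrite mem_cat mem_nseq mem_rev => /orP[/andP[_ /eqP ->]|].
    exact: look_rewind.
  case/flattenP => l /mapP[b /(allP hbs) hb ->] hl.
  by apply: look_rewind => //; exact: sub_marked hl.
Qed.

Definition round_time bs j := (2 * (j + size (blocks_tape bs)) + 3).

Lemma runs_round s bs j Z : s \in letters -> all block_ok bs ->
  runs (round_time bs j) (pick_cfg bs j (s :: Z))
    (pick_cfg [seq block_update b s | b <- bs] j.+1 Z).
Proof.
move=> hs hbs; have hs' := letters_symbols hs.
have hn : (s == 4) ==> ~~ has block_matched bs.
  by move: hs; rewrite !inE => /or3P[] /eqP ->.
have -> : round_time bs j =
    (j + size (blocks_tape bs)).+2 + size (blocks_tape bs) + 1 + j.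
  by rewrite /round_time; lia.
apply: runs_trans (runs_trans (runs_trans (runs_rewind _ _ hs' hbs) _) _) _.
- exact: runs_blocks.
- exact/runs_RR/look_match_last.
have := @runs_scanR matcher 8 (nseq j 8)
  (8 :: rev (blocks_tape [seq block_update b s | b <- bs]) ++ [:: 0]) Z.
rewrite size_nseq rev_nseq /pick_cfg.
have -> : forall L, nseq j 8 ++ 8 :: L = nseq j.+1 8 ++ L.
  by move=> L; elim: (j) => //= i ->.
by apply=> a; rewrite mem_nseq => /andP[_ /eqP ->].
Qed.

Lemma block_update_all_ok bs s : all block_ok bs ->
  all block_ok [seq block_update b s | b <- bs].
Proof. by rewrite all_map; apply: sub_all => b; apply: block_update_ok. Qed.

(* The last round, where the symbol picked in v is its terminator. *)
Lemma last_round bs j Z : all block_ok bs -> exists2 t, t <= round_time bs j &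
  let cf := exec matcher t (pick_cfg bs j (4 :: Z)) in
  halted matcher cf /\ cst cf = if has block_matched bs then 1 else 3.
Proof.
move=> hbs; have hr := @runs_rewind 4 bs j Z isT hbs.
case: (boolP (has block_matched bs)) => hm; last first.
  exists ((j + size (blocks_tape bs)).+2 + size (blocks_tape bs) + 1).
    by rewrite /round_time; lia.
  by rewrite (runs_trans hr (@runs_blocks 4 _ _ _ isT hbs hm) 1).
(* The machine halts at the first matched block, so [runs_blocks] applies to the blocks before
   it. *)
have [b [bs1 [bs2 [hb h1 ebs]]]] :
    exists b bs1 bs2, [/\ block_matched b, ~~ has block_matched bs1 & bs = bs1 ++ b :: bs2].
  elim: (bs) hm => //= b bs' IH; case: (boolP (block_matched b)) => [hb _|hb].
    by exists b, [::], bs'.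
  by move=> /IH[c [bs1 [bs2 [hc h1 ->]]]]; exists c, (b :: bs1), bs2; rewrite /= negb_or hb.
have ok1 : all block_ok bs1 by move: hbs; rewrite ebs all_cat => /andP[].
case: b hb ebs => [[n [|//]] [|//]] _ ebs.
have eb : blocks_tape bs = blocks_tape bs1 ++ nseq n 5 ++ 4 :: blocks_tape bs2.
  by rewrite ebs /blocks_tape map_cat flatten_cat /= -!catA.
have es := congr1 size eb; rewrite !size_cat size_nseq /= in es.
exists ((j + size (blocks_tape bs)).+2 + size (blocks_tape bs1) + n + 1).
  by rewrite /round_time; lia.
move: hr; rewrite {2}eb -!catA => hr.
have h2 := runs_trans hr (@runs_blocks 4 _ _ _ isT ok1 h1).
by rewrite (runs_trans h2 (@runs_fives 4 _ _ _ isT) 1).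
Qed.

Definition run_blocks bs v := [seq foldl block_update b v | b <- bs].

Lemma runs_rounds bs j v E : all (mem letters) v -> all block_ok bs ->
  exists2 t, t <= (size v).+1 * (2 * (j + size v + size (blocks_tape bs)) + 3) &
  let cf := exec matcher t (pick_cfg bs j (v ++ 4 :: E)) in
  halted matcher cf /\ cst cf = if has block_matched (run_blocks bs v) then 1 else 3.
Proof.
elim: v bs j => [|s v IH] bs j /=.
  move=> _ hbs; have [t ht h] := last_round j E hbs.
  by exists t; [rewrite /round_time in ht; lia | rewrite /run_blocks /= map_id].
case/andP=> hs hv hbs.
have [t ht [h1 h2]] := IH _ j.+1 hv (block_update_all_ok s hbs).
exists (round_time bs j + t).
  by rewrite size_blocks_update in ht; rewrite /round_time; lia.
rewrite runs_round //; split=> //; rewrite h2.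
by rewrite /run_blocks -map_comp.
Qed.

(** If [u] first differs from [v] at a letter, or is shorter, the flag is cleared and never set
    again; if it is longer, unread letters remain. *)
Lemma block_matched_fold n u t v :
  block_matched (foldl block_update (n, u, t) v) = t && (u == v).
Proof.
elim: v n u t => [|s v IH] n u t /=; first by rewrite /block_matched andbC; case: u.
case: u => [|x u]; rewrite /block_update /= ?IH ?andbF //.
by case: eqP => [->|xs]; rewrite IH //= ?eqseq_cons ?eqxx // ; case: eqP => [[]|]; rewrite ?andbF.
Qed.

Definition words_tape us := flatten [seq u ++ [:: 4] | u <- us].

(** The symbol before the last block is a terminator, or the blank if there is no other block;
    either one stops the leftward scan of state 7. *)
Lemma rev_words_tape us : exists2 a, a \in [:: 0; 4] &
  exists L, rev (words_tape us) ++ [:: 0] = a :: L.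
Proof.
case/lastP: us => [|us u]; first by exists 0 => //; exists [::].
exists 4 => //; rewrite /words_tape map_rcons -cats1 flatten_cat rev_cat /= cats0 rev_cat.
by eexists.
Qed.

Lemma matcher_correct us v : all (all (mem letters)) us -> all (mem letters) v ->
  let w := words_tape us ++ v ++ [:: 4] in
  exists2 t, t <= 2 * size w ^ 2 + 5 * size w + 3 &
  let cf := exec matcher t (init_config w) in
  halted matcher cf /\ cst cf = if v \in us then 1 else 3.
Proof.
move=> hus hv w; pose bs := [seq (0, u, true) | u <- us].
have ew : words_tape us = blocks_tape bs by rewrite /blocks_tape -map_comp.
have hbs : all block_ok bs by rewrite all_map.
have [t ht] := runs_rounds 0 [:: 0] hv hbs.
have -> : has block_matched (run_blocks bs v) = (v \in us).
  rewrite /run_blocks /bs -map_comp has_map -has_pred1.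
  by apply: eq_has => u; rewrite /= block_matched_fold.
(* The final 0 is the blank cell after the input, visited while looking for the right end. *)
move=> h; suff hi : runs (size w + size v + 5) (init_config w) (pick_cfg bs 0 (v ++ [:: 4; 0])).
  exists (size w + size v + 5 + t); last by rewrite /= hi.
  by rewrite /w !size_cat ew /= in ht *; nia.
have hw : all (mem symbols) w.
  rewrite !all_cat /= andbT; apply/andP; split; last exact: sub_all letters_symbols _ hv.
  apply/allP => x /flattenP[l /mapP[u /(allP hus) hu ->]].
  by rewrite mem_cat inE => /orP[/(allP hu)/letters_symbols|/eqP ->].
have e2 : rev w ++ [:: 0] = 4 :: rev v ++ rev (blocks_tape bs) ++ [:: 0].
  by rewrite /w !rev_cat ew -!catA.
have ehw : head 0 w \in symbols.
  by case: (w) hw e2 => [|a l] //= /andP[].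
(* The summands are: step left to the blank, turn, scan [w], turn at the right blank, pass the last
   terminator, scan [v] backwards, step onto its first symbol. *)
have -> : size w + size v + 5 = 1 + (1 + (size w + (1 + (1 + (size v + 1))))) by lia.
apply: runs_trans (@runs_RL _ 0 4 (head 0 w) [::] w _) _.
  by move: ehw; rewrite !inE => /or4P[] /eqP ->.
have -> : head 0 w :: behead w = w by case: (w) ehw.
apply: runs_trans (@runs_LR _ 4 5 0 [::] w _) _ => //.
have hs : forall a, a \in w -> lookup matcher 5 a = Some (5, a, MRight).
  by move=> a /(allP hw); rewrite !inE => /or4P[] /eqP ->.
have := runs_scanR [:: 0] [::] hs; rewrite cats0 e2 => {hs} h1.
apply: runs_trans h1 _; apply: runs_trans (@runs_RL _ 5 6 0 _ [::] _) _ => //.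
apply: runs_trans (@runs_LL _ 6 4 7 4 _ _ _) _ => //.
have hs : forall a, a \in rev v -> lookup matcher 7 a = Some (7, a, MLeft).
  by move=> a; rewrite mem_rev => /(allP hv); rewrite !inE => /or3P[] /eqP ->.
have := runs_scanL (rev (blocks_tape bs) ++ [:: 0]) [:: 4; 0] hs; rewrite size_rev revK => h2.
apply: runs_trans h2 _; rewrite -[X in runs 1 _ X]/(cfgR _ _ _).
have [a ha [L eL]] := rev_words_tape us.
rewrite /pick_cfg /= -ew eL.
by apply: (@runs_LR _ 7 8 a (a :: L)); move: ha; rewrite !inE => /orP[] /eqP ->.
Qed.

End Matcher.

(** * Encoding of instances *)

Lemma odd_div_inj n a b : a < 2 ^ n -> b < 2 ^ n ->
  (forall i, i < n -> odd (a %/ 2 ^ i) = odd (b %/ 2 ^ i)) -> a = b.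
Proof.
elim: n a b => [|n IH] a b; first by rewrite expn0 !ltnS !leqn0 => /eqP -> /eqP ->.
move=> ha hb h; rewrite -(odd_double_half a) -(odd_double_half b).
have := h 0 isT; rewrite expn0 !divn1 => ->.
rewrite (IH a./2 b./2) //.
- by rewrite expnS in ha; lia.
- by rewrite expnS in hb; lia.
by move=> i hi; have := h i.+1 hi; rewrite expnS -!divn2 !divnMA.
Qed.

Lemma bits_inj : injective bits.
Proof.
move=> a b h; have hs := congr1 size h; rewrite !size_rev !size_mkseq in hs.
have hm := can_inj (@revK _) h; move: hm; rewrite -hs => hm.
apply: (@odd_div_inj (trunc_log 2 a).+1).
- exact: trunc_log_ltn.
- by rewrite hs trunc_log_ltn.
by move=> i hi; rewrite -(nth_mkseq false (fun j => odd (a %/ 2 ^ j)) hi) hm nth_mkseq.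
Qed.

Lemma enc_nat_inj : injective enc_nat.
Proof. by move=> a b /inj_map h; apply/bits_inj/h; do 2 case. Qed.

Lemma enc_nat_letters a : all (mem [:: 1; 2]) (enc_nat a).
Proof. by rewrite all_map; apply/allP; case. Qed.

Lemma size_enc_nat a : size (enc_nat a) = size2 a.
Proof. by rewrite size_map size_rev size_mkseq. Qed.

Lemma cat_sep_inj (T : eqType) (x : T) s1 s2 t1 t2 : x \notin s1 -> x \notin s2 ->
  s1 ++ x :: t1 = s2 ++ x :: t2 -> s1 = s2 /\ t1 = t2.
Proof.
elim: s1 s2 => [|a s1 IH] [|b s2] /=; rewrite ?inE ?negb_or.
- by move=> _ _ [].
- by move=> _ /andP[/eqP hb _] [].
- by move=> /andP[/eqP ha _] _ [/esym].
move=> /andP[_ h1] /andP[_ h2] [-> e].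
by have [-> ->] := IH _ h1 h2 e.
Qed.

Definition enc_entries (es : seq nat) := flatten [seq enc_nat a ++ [:: 3] | a <- es].

(** The separator 3 occurs in no encoded number, so the first separator cuts off the first entry. *)
Lemma enc_entries_inj : injective enc_entries.
Proof.
have hn a : 3 \notin enc_nat a by apply/negP => /(allP (enc_nat_letters a)).
rewrite /enc_entries; elim=> [|a s IH] [|b t] //=.
- by case: (enc_nat b).
- by case: (enc_nat a).
by rewrite -!catA /= => /(cat_sep_inj (hn a) (hn b))[/enc_nat_inj -> /IH ->].
Qed.

Section Encoding.
Variable k : nat.
Implicit Types (A W C : mx k) (I : inst k).

Definition entries A := [seq A i j | i <- enum 'I_k, j <- enum 'I_k].

Lemma entries_inj : injective entries.
Proof.
move=> A B; rewrite /entries => h; apply/matrixP => i j.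
(* Both lists become maps over one list of index pairs, so that they can be compared pointwise. *)
have : [seq A p.1 p.2 | p <- [seq (i, j) | i <- enum 'I_k, j <- enum 'I_k]] =
       [seq B p.1 p.2 | p <- [seq (i, j) | i <- enum 'I_k, j <- enum 'I_k]].
  by rewrite !map_allpairs.
move/eq_in_map/(_ (i, j)); apply.
by apply: (allpairs_f pair); rewrite mem_enum.
Qed.

Lemma enc_mxE A : enc_mx A = enc_entries (entries A) ++ [:: 4].
Proof. by rewrite /enc_mx /enc_entries /entries map_allpairs. Qed.

Lemma enc_instE I : enc_inst I =
  words_tape [seq enc_entries (entries W) | W <- I.1] ++ enc_entries (entries I.2) ++ [:: 4].
Proof.
rewrite /enc_inst /words_tape enc_mxE -map_comp; congr (flatten _ ++ _).
by apply: eq_map => W; rewrite enc_mxE.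
Qed.

Lemma enc_entries_letters es : all (mem letters) (enc_entries es).
Proof.
apply/allP => a /flattenP[l /mapP[x _ ->]]; rewrite mem_cat => /orP[|].
  by move/(allP (enc_nat_letters x)); rewrite /= !inE => /orP[] ->; rewrite ?orbT.
by rewrite !inE => /eqP ->.
Qed.

(** The word has k^2 separators and a terminator, where [size2_mx] adds k^2 - 1. *)
Lemma size_enc_mx A : 0 < k -> size (enc_mx A) = (size2_mx A).+2.
Proof.
move=> k0; rewrite enc_mxE size_cat /enc_entries size_flatten /shape -map_comp sumnE big_map.
rewrite /entries big_allpairs_dep /= big_enum /=.
under eq_bigr => i _.
  rewrite big_enum /=; under eq_bigr => j _ do rewrite size_cat size_enc_nat.
  rewrite big_split /= sum_nat_const card_ord; over.
rewrite big_split /= sum_nat_const card_ord /size2_mx muln1 mulnn.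
have -> : \sum_(i in 'I_k) \sum_(j in 'I_k) size2 (A i j) =
    \sum_(i < k) \sum_(j < k) size2 (A i j).
  by apply: eq_big => // i _; apply: eq_big.
by have : 0 < k ^ 2; [rewrite expn_gt0 k0 | lia].
Qed.

Lemma size_enc_inst I : 0 < k -> size (enc_inst I) <= 2 * size2_inst I + 2.
Proof.
move=> k0; rewrite /enc_inst size_cat size_enc_mx // size_flatten /shape -map_comp sumnE big_map.
have -> : \sum_(W <- I.1) size (enc_mx W) = \sum_(W <- I.1) size2_mx W + 2 * size I.1.
  elim: I.1 => [|W s IH]; first by rewrite !big_nil.
  by rewrite !big_cons IH size_enc_mx //=; lia.
by rewrite /size2_inst; lia.
Qed.

Lemma matcher_enc I : 0 < k -> exists2 t, t <= 100 * size2_inst I ^ 2 + 100 &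
  let cf := exec matcher t (init_config (enc_inst I)) in
  halted matcher cf /\ cst cf = if I.2 \in I.1 then 1 else 3.
Proof.
move=> k0; have := @matcher_correct [seq enc_entries (entries W) | W <- I.1]
  (enc_entries (entries I.2)).
rewrite all_map -enc_instE (mem_map (f := fun W => enc_entries (entries W))); last first.
  by move=> A B /enc_entries_inj/entries_inj.
case=> [||t ht h].
- by apply/allP => W _; exact: enc_entries_letters.
- exact: enc_entries_letters.
exists t => //; apply: leq_trans ht _; have := size_enc_inst I k0.
move: (size _) (size2_inst I) => n x hn; have : n ^ 2 <= (2 * x + 2) ^ 2 by rewrite leq_exp2r.
by rewrite -!mulnn; have : x <= x * x; nia.
Qed.

(** * Instances whose target is a weight *)

Lemma factors_nseq0 (Ws : seq (mx k)) : factors (nseq (size Ws) 0) Ws = [::].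
Proof. by elim: Ws. Qed.

Lemma SSP_mem I : I.2 \in I.1 -> SSP I.
Proof.
case: I => Ws C /= /splitPr[s t].
have zipE : zip (nseq (size s) 0 ++ 1 :: nseq (size t) 0) (s ++ C :: t) =
    zip (nseq (size s) 0) s ++ (1, C) :: zip (nseq (size t) 0) t.
  by rewrite zip_cat ?size_nseq.
exists (nseq (size s) 0 ++ 1 :: nseq (size t) 0); split=> /=.
  by rewrite !size_cat /= !size_nseq.
split; first by rewrite all_cat /= !all_nseq !orbT.
split; first by rewrite has_cat /= orbT.
rewrite /factors zipE map_cat flatten_cat /= -/(factors _ _) factors_nseq0.
by rewrite -/(factors _ _) factors_nseq0.
Qed.

Lemma KP_mem I : I.2 \in I.1 -> KP I.
Proof. by move/SSP_mem => [xs [? [_ [? ?]]]]; exists xs. Qed.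
End Encoding.

(** * Instances with a large target *)

Lemma leq_size_inj (S T : eqType) (f : S -> T) (s : seq S) (t : seq T) :
  uniq s -> {in s &, injective f} -> {in s, forall x, f x \in t} -> size s <= size t.
Proof.
move=> us fi ft; rewrite -(size_map f); apply: uniq_leq_size.
  by rewrite map_inj_in_uniq.
by move=> _ /mapP[x xs ->]; apply: ft.
Qed.

Lemma size2_gt a : a < 2 ^ size2 a.
Proof. exact: trunc_log_ltn. Qed.

Lemma size2_pow2D e r : r < 2 ^ e -> size2 (2 ^ e + r) = e.+1.
Proof. by move=> h; rewrite /size2 (@trunc_log_eq _ e) // leq_addr expnS; lia. Qed.

Lemma size2_divn a e : e < size2 a -> size2 (a %/ 2 ^ e) = size2 a - e.
Proof.
case: a => [|a]; first by rewrite /size2 trunc_log0 ltnS leqn0 => /eqP ->.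
rewrite /size2 ltnS => h; have /andP[h1 h2] := @trunc_log_bounds 2 a.+1 isT isT.
rewrite (@trunc_log_eq _ (trunc_log 2 a.+1 - e)) ?subSn //.
rewrite leq_divRL ?expn_gt0 // -expnD subnK // h1 /=.
by rewrite ltn_divLR ?expn_gt0 // -expnD addSn subnK.
Qed.

Lemma divn_pow2_split a e f :
  a = a %/ 2 ^ (f + e) * 2 ^ (f + e) + (a %/ 2 ^ e) %% 2 ^ f * 2 ^ e + a %% 2 ^ e.
Proof.
rewrite {1}(divn_eq a (2 ^ e)) {1}(divn_eq (a %/ 2 ^ e) (2 ^ f)) -divnMA -expnD.
by rewrite [e + f]addnC mulnDl -mulnA -expnD.
Qed.

Section Density.
Variable k : nat.
Hypothesis k_gt0 : 0 < k.
Implicit Types (A W C : mx k) (I : inst k) (p : 'I_k * 'I_k) (Ws : seq (mx k)).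

Definition set_entry A p x : mx k := (\matrix_(i, j) if (i, j) == p then x else A i j)%R.

Lemma set_entryE A p x i j : set_entry A p x i j = if (i, j) == p then x else A i j.
Proof. by rewrite mxE. Qed.

Lemma size2_mxE A : size2_mx A = \sum_p size2 (A p.1 p.2) + (k ^ 2).-1.
Proof.
rewrite /size2_mx (pair_big xpredT xpredT (fun i j => size2 (A i j))) /= -subn1 addnBA //.
by rewrite expn_gt0 k_gt0.
Qed.

Lemma size2_set_entry A p x :
  size2_mx (set_entry A p x) + size2 (A p.1 p.2) = size2_mx A + size2 x.
Proof.
rewrite !size2_mxE (bigD1 p) //= [in RHS](bigD1 p) //= set_entryE -surjective_pairing eqxx.
rewrite (eq_bigr (fun q => size2 (A q.1 q.2))); first by lia.
by move=> q qp; rewrite set_entryE -surjective_pairing (negPf qp).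
Qed.

Lemma leq_size2_entry A p : size2 (A p.1 p.2) <= size2_mx A.
Proof. by rewrite size2_mxE (bigD1 p) //=; lia. Qed.

Lemma size2_const1 : size2_mx (const_mx 1 : mx k) = k ^ 2 + (k ^ 2).-1.
Proof.
rewrite size2_mxE (eq_bigr (fun _ => 1)); last by move=> p _; rewrite mxE.
by rewrite sum1_card card_prod card_ord mulnn.
Qed.

Lemma exists_big_entry C n : k ^ 2 * n + k ^ 2 <= size2_mx C -> exists p, n <= size2 (C p.1 p.2).
Proof.
move=> h; apply/existsP; apply: contraLR h; rewrite negb_exists => /forallP h.
rewrite -ltnNge size2_mxE; have : 0 < k ^ 2 by rewrite expn_gt0 k_gt0.
suff : \sum_p size2 (C p.1 p.2) <= k ^ 2 * n by lia.
have -> : k ^ 2 * n = \sum_(p : 'I_k * 'I_k) n.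
  by rewrite sum_nat_const card_prod card_ord mulnn.
by apply: leq_sum => p _; have := h p; rewrite -ltnNge; apply: ltnW.
Qed.

Section Cut.
Variable D : nat.
(** The price of one more all-one matrix: k^2 bits for its entries, k^2 - 1 in [size2_mx], and 1 for
    the larger number of weights. *)
Let K2 := 2 * k ^ 2.

Definition cut_entry C : 'I_k * 'I_k :=
  odflt (Ordinal k_gt0, Ordinal k_gt0) [pick p | D + K2 <= size2 (C p.1 p.2)].

(** The bits of the chosen entry are split in three. The high ones stay in the old target, which
    becomes the last weight; the low [e] ones go, behind a leading 1, into the new target; the [K2]
    middle ones leave the instance and pay for the new matrix. They and the position are kept as
    side information, whose range does not depend on [D]. *)
Definition cut_inst (x : inst k * nat) : inst k * (('I_k * 'I_k) * 'I_(2 ^ K2)) :=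
  let: (J, e) := x in
  let p := cut_entry J.2 in
  let a := J.2 p.1 p.2 in
  ((rcons J.1 (set_entry J.2 p (a %/ 2 ^ (K2 + e))),
    set_entry (const_mx 1) p (2 ^ e + a %% 2 ^ e)),
   (p, Ordinal (ltn_pmod (a %/ 2 ^ e) (expn_gt0 2 K2)))).

Definition cuttable I := [exists p, D + K2 <= size2 (I.2 p.1 p.2)].

Lemma cut_entryP I : cuttable I -> 
  D + K2 <= size2 (I.2 (cut_entry I.2).1 (cut_entry I.2).2).
Proof. by move=> /existsP[p hp]; rewrite /cut_entry; case: pickP => //= /(_ p); rewrite hp. Qed.

Lemma cut_inst_valid I e : cuttable I -> e < D -> valid_inst I ->
  valid_inst (cut_inst (I, e)).1.
Proof.
move=> /cut_entryP hI he [hW hC]; split=> /=.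
  move=> W; rewrite mem_rcons inE => /predU1P[->|/hW //] i j.
  rewrite set_entryE; case: eqP => // _; rewrite divn_gt0 ?expn_gt0 //.
  (* The entry has more than [K2 + e] bits, hence its high part is not 0. *)
  apply: leq_trans (@trunc_logP 2 _ isT (hC _ _)); rewrite leq_exp2l //.
  by rewrite /size2 in hI; lia.
move=> i j; rewrite set_entryE mxE; case: eqP => // _.
by rewrite addn_gt0 expn_gt0.
Qed.

Lemma cut_inst_size I e : cuttable I -> e < D ->
  size2_inst (cut_inst (I, e)).1 = size2_inst I.
Proof.
move=> /cut_entryP; set p := cut_entry _ => hI he; rewrite /size2_inst /= -/p.
set a := I.2 _ _ in hI *.
have h1 := size2_set_entry I.2 p (a %/ 2 ^ (K2 + e)).
have h2 := size2_set_entry (const_mx 1) p (2 ^ e + a %% 2 ^ e).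
rewrite size2_divn -/a in h1; last by lia.
rewrite size2_pow2D ?ltn_pmod ?expn_gt0 // mxE size2_const1 in h2.
have : 0 < k ^ 2 by rewrite expn_gt0 k_gt0.
have e1 : size2 1 = 1 by [].
by rewrite size_rcons big_rcons /= e1 /K2 in hI h1 h2 *; lia.
Qed.

Lemma cut_inst_inj s : {in [seq (J, e) | J <- filter cuttable s, e <- iota 0 D] &,
  injective cut_inst}.
Proof.
move=> [[Ws C] e] [[Ws' C'] e'] _ _ /= [].
set p := cut_entry C; set p' := cut_entry C'.
move=> /rcons_inj[<- eW] eC ep ed; move: eW eC; rewrite -ep => eW eC.
have elo : 2 ^ e + C p.1 p.2 %% 2 ^ e = 2 ^ e' + C' p.1 p.2 %% 2 ^ e'.
  by have /matrixP/(_ p.1 p.2) := eC; rewrite !set_entryE -surjective_pairing eqxx.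
have ehi : C p.1 p.2 %/ 2 ^ (K2 + e) = C' p.1 p.2 %/ 2 ^ (K2 + e').
  by have /matrixP/(_ p.1 p.2) := eW; rewrite !set_entryE -surjective_pairing eqxx.
(* The leading 1 lets [e] be read off from the bit length of the low part. *)
have ee : e = e'.
  by have := congr1 size2 elo; rewrite !size2_pow2D ?ltn_pmod ?expn_gt0 // => -[].
rewrite -{}ee -?ep in elo ehi ed *; congr (_, _, _).
apply/matrixP => i j; case: (eqVneq (i, j) p) => [ij|ij].
  have -> : i = p.1 by rewrite -ij.
  have -> : j = p.2 by rewrite -ij.
  rewrite (divn_pow2_split (C _ _) e K2) (divn_pow2_split (C' _ _) e K2) ehi ed.
  by congr (_ + _); apply/eqP; rewrite -(eqn_add2l (2 ^ e)) elo.
by have /matrixP/(_ i j) := eW; rewrite !set_entryE (negPf ij).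
Qed.

Lemma count_cuttable (s : seq (inst k)) m : uniq s ->
  (forall I, I \in s <-> valid_inst I /\ size2_inst I = m) ->
  D * count cuttable s <= k ^ 2 * 2 ^ K2 * size s.
Proof.
move=> us hs.
have := @leq_size_inj _ _ cut_inst [seq (J, e) | J <- filter cuttable s, e <- iota 0 D]
  [seq (J, x) | J <- s, x <- enum {: ('I_k * 'I_k) * 'I_(2 ^ K2)}].
rewrite !size_allpairs size_filter size_iota -cardE !card_prod !card_ord mulnn.
rewrite mulnC [X in _ -> _ -> _ -> _ <= X]mulnC; apply.
- by apply: allpairs_uniq; rewrite ?filter_uniq ?iota_uniq // => -[? ?] [? ?].
- exact: cut_inst_inj.
move=> _ /allpairsP[[I e] /= [hI he ->]].
move: hI he; rewrite mem_filter mem_iota add0n => /andP[hI /hs[hv hm]] he.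
rewrite [cut_inst _]surjective_pairing; apply: (allpairs_f pair); last by rewrite mem_enum.
by apply/hs; split; [apply: cut_inst_valid | rewrite cut_inst_size].
Qed.
End Cut.

Lemma count_large_target E : exists R, forall (s : seq (inst k)) m, uniq s ->
  (forall I, I \in s <-> valid_inst I /\ size2_inst I = m) ->
  E * count (fun I => R <= size2_mx I.2) s <= size s.
Proof.
set c := k ^ 2 * 2 ^ (2 * k ^ 2); set D := c * E.
(* A target of this size has an entry that can be cut at [D] places; as [D] is [c * E], the side
   information factor [c] cancels. *)
exists (k ^ 2 * (D + 2 * k ^ 2) + k ^ 2) => s m us hs.
have c0 : 0 < c by rewrite muln_gt0 !expn_gt0 k_gt0.
rewrite -(leq_pmul2l c0) mulnA; apply: leq_trans (count_cuttable D us hs).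
rewrite leq_mul2l; apply/orP; right; apply: sub_count => I /= h.
by apply/existsP/exists_big_entry.
Qed.

End Density.

(** * Exchanging the target *)

Section Swap.
Variable k : nat.
Hypothesis k_gt0 : 0 < k.
Implicit Types (A W C : mx k) (I J : inst k) (Q : inst k -> bool).

Definition swap_target i I : inst k :=
  (set_nth I.2 I.1 i I.2, nth I.2 I.1 i).

Lemma size_swap i I : i < size I.1 -> size (swap_target i I).1 = size I.1.
Proof. by move=> hi; rewrite size_set_nth; apply/maxn_idPr. Qed.

Lemma swap_targetK i I : i < size I.1 -> swap_target i (swap_target i I) = I.
Proof.
case: I => Ws C /= hi; rewrite /swap_target /=; set C' := nth C Ws i.
have hs : size (set_nth C Ws i C) = size Ws by apply: (@size_swap i (Ws, C)).
congr (_, _); last by rewrite (set_nth_default C) ?hs // nth_set_nth /= eqxx.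
apply: (@eq_from_nth _ C'); first by rewrite size_set_nth hs; apply/maxn_idPr.
move=> j; rewrite size_set_nth hs nth_set_nth /= => hj; have {}hj : j < size Ws by lia.
case: eqP => [->|/eqP ji]; first by rewrite (set_nth_default C).
by rewrite (set_nth_default C) ?hs // nth_set_nth /= (negPf ji) (set_nth_default C').
Qed.

Lemma perm_swap i I : i < size I.1 ->
  perm_eq ((swap_target i I).2 :: (swap_target i I).1) (I.2 :: I.1).
Proof.
case: I => Ws C /= hi; rewrite /swap_target /= set_nthE hi.
rewrite -[in X in perm_eq _ X](cat_take_drop i Ws) (drop_nth C hi).
by apply/permP => a; rewrite /= !count_cat /=; lia.
Qed.

Lemma swap_valid m i I : i < size I.1 -> valid_inst I /\ size2_inst I = m ->
  valid_inst (swap_target i I) /\ size2_inst (swap_target i I) = m.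
Proof.
move=> hi [[hW hC] hm]; have hp := perm_swap hi; split.
  have h W : W \in (swap_target i I).2 :: (swap_target i I).1 -> valid_mx W.
    by rewrite (perm_mem hp) inE => /predU1P[->|/hW].
  by split=> [W hW'|]; apply: h; rewrite inE ?hW' ?orbT ?eqxx.
rewrite -hm /size2_inst size_swap //; congr (_ + _).
have := perm_big _ hp (op := addn) (x := 0) (P := xpredT) (F := @size2_mx k).
by rewrite !big_cons /= addnC => ->; rewrite addnC.
Qed.

Section Stratum.
Variables (m : nat) (s : seq (inst k)).
Hypothesis s_uniq : uniq s.
Hypothesis mem_s : forall I, I \in s <-> valid_inst I /\ size2_inst I = m.

(** Swapping while keeping the index is an involution on the pairs (instance, index), since it
    preserves the stratum and the number of weights; the sum is reindexed along it. *)
Lemma sum_swap Q :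
  \sum_(I <- s) \sum_(i <- iota 0 (size I.1)) Q (swap_target i I) =
  \sum_(I <- s) Q I * size I.1.
Proof.
pose L := [seq (J, i) | J <- s, i <- iota 0 (size J.1)].
pose f (x : inst k * nat) := (swap_target x.2 x.1, x.2).
have memL x : (x \in L) = (x.1 \in s) && (x.2 < size x.1.1).
  apply/allpairsPdep/andP => [[J [i [hJ hi ->]]]|[h1 h2]]; first by rewrite mem_iota in hi.
  by exists x.1, x.2; rewrite mem_iota -surjective_pairing.
have uL : uniq L.
  apply: allpairs_uniq_dep => // [J _|]; first exact: iota_uniq.
  by move=> [? ?] [? ?] _ _ /= [-> ->].
have fL x : x \in L -> f x \in L.
  by rewrite !memL /= => /andP[/mem_s h hi]; rewrite size_swap // hi andbT; apply/mem_s/swap_valid.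
have fK x : x \in L -> f (f x) = x.
  by rewrite memL /f /= => /andP[_ hi]; rewrite swap_targetK // -surjective_pairing.
have pL : perm_eq (map f L) L.
  apply: uniq_perm => //.
    by rewrite map_inj_in_uniq // => x y hx hy e; rewrite -(fK x hx) e fK.
  move=> x; apply/mapP/idP => [[y hy ->]|hx]; first exact: fL.
  by exists (f x); [apply: fL | rewrite fK].
transitivity (\sum_(x <- L) (Q (f x).1 : nat)); first by rewrite big_allpairs_dep.
rewrite -(big_map f xpredT (fun x => Q x.1 : nat)) (perm_big _ pL) big_allpairs_dep /=.
apply: eq_bigr => J _; rewrite big_const_seq count_predT size_iota iter_addn_0 mulnC.
by rewrite mulnC.
Qed.

(** A finite list containing all matrices of size below [R]; its length does not depend on the
    stratum. *)
Definition small_mxs R : seq (mx k) :=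
  [seq map_mx (@nat_of_ord (2 ^ R)) B | B <- enum {: 'M['I_(2 ^ R)]_k}].

Lemma mem_small_mxs R A : size2_mx A < R -> A \in small_mxs R.
Proof.
move=> h; have lt i j : A i j < 2 ^ R.
  apply: leq_trans (size2_gt _) _; rewrite leq_exp2l //.
  by apply: leq_trans (ltnW h); apply: (leq_size2_entry k_gt0 A (i, j)).
apply/mapP; exists (\matrix_(i, j) Ordinal (lt i j))%R; first by rewrite mem_enum.
by apply/matrixP => i j; rewrite !mxE.
Qed.

(* A matrix Ws_i which becomes a target not occurring among the other matrices *)
(* after the swap is determined by its value: at most one i for each value.    *)
Lemma count_small_bad R T :
  T * count (fun I => [&& I.2 \notin I.1, size2_mx I.2 < R & T <= size I.1]) s
    <= size (small_mxs R) * size s.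
Proof.
pose Q I := (I.2 \notin I.1) && (size2_mx I.2 < R).
apply: (@leq_trans (\sum_(I <- s) Q I * size I.1)).
  rewrite -sum1_count big_distrr /= big_mkcond; apply: leq_sum => J _.
  by rewrite /Q; case: ifP => // /and3P[-> -> h]; rewrite muln1 mul1n.
rewrite -sum_swap -(sum1_size s) big_distrr /=; apply: leq_sum => J _; rewrite muln1.
rewrite -(big_mkcond (fun i => Q (swap_target i J)) (fun=> 1)) /= sum1_count -size_filter.
apply: (leq_size_inj (f := nth J.2 J.1)).
- by rewrite filter_uniq ?iota_uniq.
- move=> i j; rewrite !mem_filter !mem_iota !add0n => /andP[/andP[/= hi _] li] /andP[_ lj] eij.
  apply/eqP; apply: contraNT hi => ij; apply/(nthP J.2); exists j.
    by rewrite size_set_nth leq_max lj orbT.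
  by rewrite nth_set_nth /= eq_sym (negPf ij) -eij.
by move=> i; rewrite mem_filter => /andP[/andP[_ /mem_small_mxs]].
Qed.

(** Moving a large weight into the target keeps the instance short, and an instance with n weights
    is the image of only n pairs (instance, index). *)
Lemma count_short R T :
  count (fun I => (size I.1 <= T) && has (fun W => R <= size2_mx W) I.1) s
    <= T * count (fun I => R <= size2_mx I.2) s.
Proof.
pose Q I := (size I.1 <= T) && (R <= size2_mx I.2).
apply: (@leq_trans (\sum_(I <- s) Q I * size I.1)); last first.
  rewrite -sum1_count big_distrr /= [leqRHS]big_mkcond; apply: leq_sum => J _.
  rewrite /Q; case: (leqP R _) => hR; rewrite ?andbF ?andbT // muln1.
  by case: (leqP (size J.1) T) => hT; rewrite ?mul1n.
rewrite -sum_swap -sum1_count big_mkcond; apply: leq_sum => J _.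
case: ifP => // /andP[hT /(has_nthP J.2)[i hi hR]].
rewrite (bigD1_seq i) ?mem_iota ?iota_uniq //=.
by rewrite /Q size_swap // hT hR.
Qed.
End Stratum.

(** * Instances whose target is not a weight *)

Lemma short_stratum R T I : T.+1 * R.+1 <= size2_inst I -> size I.1 <= T ->
  has (fun W => R <= size2_mx W) I.1 || (R <= size2_mx I.2).
Proof.
move=> hm hT; apply: contraLR hm; rewrite negb_or -ltnNge -all_predC => /andP[/allP hW].
rewrite -ltnNge => hC.
suff : \sum_(W <- I.1) size2_mx W <= size I.1 * R by rewrite /size2_inst; nia.
rewrite -sum1_size big_distrl /= big_seq [leqRHS]big_seq; apply: leq_sum => W /hW /=.
by rewrite -ltnNge mul1n => /ltnW.
Qed.

Lemma count_missing_target E : exists M, forall m (s : seq (inst k)), M <= m -> uniq s ->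
  (forall I, I \in s <-> valid_inst I /\ size2_inst I = m) ->
  E * count (fun I => I.2 \notin I.1) s <= size s.
Proof.
have [R1 h1] := count_large_target k_gt0 (3 * E).
set T := 3 * E * (size (small_mxs R1)).+1.
have [R2 h2] := count_large_target k_gt0 (3 * E * T.+1).
exists (T.+1 * R2.+1) => m s hm us hs.
have := h1 s m us hs; have := h2 s m us hs.
have := count_small_bad us hs R1 T; have := count_short us hs R2 T.
set c1 := count _ s; set c2 := count _ s; set c3 := count _ s; set c4 := count _ s.
(* The target has size at least [R1]; or it is smaller and there are at least [T] weights; or the
   instance is short, and then by [short_stratum] a weight or the target has size at least [R2]. *)
have : count (fun I => I.2 \notin I.1) s <= c1 + c2 + c3 + c4.
  rewrite /c1 /c2 /c3 /c4 -!sum1_count ![\sum_(i <- s | _) _]big_mkcond -!big_split /=.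
  rewrite big_seq [leqRHS]big_seq; apply: leq_sum => J /hs[_ hJ].
  case: (boolP (J.2 \in J.1)) => //= _.
  case: (leqP R1 (size2_mx J.2)) => //= _; first by rewrite addn1.
  case: (leqP T (size J.1)) => //= hT; first by rewrite addn0 addn1.
  rewrite (ltnW hT); have := @short_stratum R2 T J; rewrite hJ hm (ltnW hT) => /(_ isT isT).
  by case: has => //= ->; rewrite !addnS.
(* Multiplied by 3E, each of three parts is at most [size s]: targets of size at least [R1], small
   missing targets with at least [T] weights, and the two short classes together, which are at most
   [T.+1] times the targets of size at least [R2]. *)
rewrite /T; nia.
Qed.
End Swap.

(** * From the count to the generic algorithm *)

Lemma matcher_generic k (P : inst k -> Prop) : 0 < k ->
  (forall I, I.2 \in I.1 -> P I) -> generic_ptime P.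
Proof.
move=> k0 hP; exists matcher, 100, 2; split.
  move=> J _; have [t ht [h1 h2]] := matcher_enc J k0; exists t; split=> //; cbv zeta; rewrite h2.
  by case: ifP => [/hP hJ|_]; do !split.
move=> cU cA hU hA e e0.
(* This bound exceeds 1/e, so a proportion of at most one in [E] is at most [e]. *)
have [M hM] := count_missing_target k0 (Num.bound e^-1).
exists M => m mM _; have [sU [uU [memU <-]]] := hU m; have [sA [_ [memA <-]]] := hA m.
have := hM m sU mM uU memU; set E := Num.bound _; set c := count _ _ => hc.
(* The machine accepts every instance whose target is a weight, so only the [c] others can be
   missing from [sA]. *)
have hsub : size sU <= size sA + c.
  rewrite -(count_predC (fun I => I.2 \in I.1)) leq_add2r -size_filter.
  apply: uniq_leq_size; first exact: filter_uniq.
  move=> J; rewrite mem_filter => /andP[hJ /memU[v sz]]; apply/memA; split=> //.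
  by have [t _ [h1 h2]] := matcher_enc J k0; exists t; cbv zeta; rewrite h2 hJ.
have hE : (e^-1 < E%:R)%R by apply: archi_boundP; rewrite invr_ge0 ltW.
apply: (@le_trans _ _ (c%:R : rat)%R); first by rewrite lerBlDl -natrD ler_nat.
have h3 : (c%:R <= e * (E * c)%:R)%R.
  rewrite natrM mulrA -[leLHS]mul1r ler_wpM2r // ?ler0n //.
  by rewrite mulrC -ler_pdivrMr // mul1r ltW.
by apply: le_trans h3 _; rewrite ler_pM2l // ler_nat.
Qed.

Theorem mainTheorem17 (k : nat) : 0 < k ->
  generic_ptime (@SSP k) /\ generic_ptime (@KP k).
Proof.
by move=> k0; split; apply: matcher_generic => // J; [apply: SSP_mem | apply: KP_mem].
Qed.
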